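(* For a poset $P$, we have $\dim_2(P) = |P|$ if and only if $P$ belongs to the family of all posets $P$ such that if $P=Q_1<\dots<Q_t$ is the block decomposition of $P$, then $Q_i\in\mathbb{A}_{2,3,4}\cup\mathbb{B}\cup\{Z\}$ for every $i\in[t]$.
   Context: All posets are finite with non-empty ground sets. $\dim_2(P)$ is the least $w$ such that $P$ has an inclusion representation $\{S_x:x\in P\}$ (i.e., $x\le y$ iff $S_x\subseteq S_y$) with $|\bigcup_x S_x|=w$. The vertical sum $Q_1<\dots<Q_t$ of posets with disjoint ground sets has $x\le y$ iff $x,y\in Q_i$ with $x\le y$ in $Q_i$, or $x\in Q_i,y\in Q_j$ with $i<j$. A poset is a vertical prime if it is not a vertical sum of two (non-empty) posets, and a block if it is a chain or a vertical prime. If $P$ is a block its block decomposition is $P$ itself ($t=1$); otherwise it is the expression $P=Q_1<\dots<Q_t$ with least $t\ge2$ and each $Q_i$ a block. $Z$ is the four-element poset with three components (a 2-element chain plus two isolated points); $\mathbb{A}_{2,3,4}$ consists of antichains of sizes 2, 3 and 4; $\mathbb{B}$ consists of all posets $C+T$ (disjoint sum) where $C$ is a chain with at least two elements and $T$ is a one-element poset. *)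

(* Defs.v *)
From mathcomp Require Import all_boot all_order.

Set Implicit Arguments.
Unset Strict Implicit.
Unset Printing Implicit Defensive.

Import Order.TTheory.

Local Open Scope order_scope.

Section Dim2.
Context {d : Order.disp_t} (P : finPOrderType d).

Definition incl_rep (U : finType) (S : P -> {set U}) : Prop :=
  forall x y : P, x <= y <-> S x \subset S y.

Definition has_incl_rep (w : nat) : Prop :=
  exists (U : finType) (S : P -> {set U}),
    incl_rep S /\ #|\bigcup_x S x| = w.

(* Decidable form of [has_incl_rep]: only labels in a w-element set are used
   (see [has_incl_repP]). *)
Definition has_incl_repb (w : nat) : bool :=
  [exists S : {ffun P -> {set 'I_w}},
     [forall x, forall y, (x <= y) == (S x \subset S y)]
     && (#|\bigcup_x S x| == w)].

Lemma has_incl_repP w : reflect (has_incl_rep w) (has_incl_repb w).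
Proof.
apply: (iffP existsP) => [[S /andP[/forallP hS /eqP cS]]|[U [S [hS cS]]]].
  exists 'I_w, S; split=> // x y.
  by move/forallP: (hS x) => /(_ y) /eqP ->.
pose V := \bigcup_x S x.
have SV x : S x \subset V by apply: bigcup_sup.
pose f (i : 'I_w) : U := enum_val (cast_ord (esym cS) i).
have fI : injective f by move=> i j /enum_val_inj /cast_ord_inj.
have fP u : u \in V -> exists i, f i = u.
  move=> uV; exists (cast_ord cS (enum_rank_in uV u)).
  by rewrite /f cast_ordK enum_rankK_in.
exists [ffun x => f @^-1: S x]; apply/andP; split.
  apply/forallP=> x; apply/forallP=> y; rewrite !ffunE; apply/eqP.
  apply/idP/idP=> [/hS sxy|sxy]; first exact: preimsetS.
  apply/hS/subsetP=> u ux.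
  have [i fi] := fP u (subsetP (SV x) u ux).
  by move/subsetP: sxy => /(_ i); rewrite !inE fi => /(_ ux).
apply/eqP; rewrite -[RHS]card_ord -cardsT; congr #|pred_of_set _|.
apply/setP=> i; rewrite inE; apply/bigcupP.
have /bigcupP[x _ fx] : f i \in V by apply: enum_valP.
by exists x => //; rewrite ffunE inE.
Qed.

Lemma has_incl_rep_exists : exists w, has_incl_repb w.
Proof.
exists #|\bigcup_(x : P) [set z : P | z <= x]|; apply/has_incl_repP.
exists P, (fun x => [set z : P | z <= x]); split=> // x y; split=> [xy|].
  by apply/subsetP=> z; rewrite !inE => /le_trans; apply.
by move/subsetP=> /(_ x); rewrite !inE lexx; apply.
Qed.

Definition dim2 : nat := ex_minn has_incl_rep_exists.

Lemma dim2P : has_incl_rep dim2 /\ forall w, has_incl_rep w -> (dim2 <= w)%N.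
Proof.
rewrite /dim2; case: ex_minnP => m hm mmin.
by split=> [|w /has_incl_repP]; [apply/has_incl_repP | apply: mmin].
Qed.

End Dim2.

(* A set [A : {set P}] below stands for the subposet of [P] induced on [A];
   in [P = Q_1 < ... < Q_t] each [Q_i] is necessarily such a subposet. *)
Section Blocks.
Context {d : Order.disp_t} {P : finPOrderType d}.
Implicit Types A B C : {set P}.

Definition chain A : Prop := {in A &, forall x y, x >=< y}.

Definition antichain A : Prop := {in A &, forall x y, x != y -> x >< y}.

Definition disjoint_sum A B C : Prop :=
  [/\ A = B :|: C, [disjoint B & C] & {in B & C, forall x y, x >< y}].

Definition vertical_sum A (t : nat) (Q : 'I_t -> {set P}) : Prop :=
  [/\ forall i, Q i != set0,
      forall i j, i != j -> [disjoint Q i & Q j],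
      A = \bigcup_i Q i
    & {in A &, forall x y, x <= y <->
        (exists i, [/\ x \in Q i, y \in Q i & x <= y]) \/
        (exists i j : 'I_t, [/\ (i < j)%N, x \in Q i & y \in Q j])}].

Definition vertical_prime A : Prop :=
  A != set0 /\ ~ exists Q : 'I_2 -> {set P}, vertical_sum A Q.

Definition block A : Prop := A != set0 /\ (chain A \/ vertical_prime A).

Definition block_sum A (t : nat) (Q : 'I_t -> {set P}) : Prop :=
  vertical_sum A Q /\ forall i, block (Q i).

(* When [t = 1], [vertical_sum A Q] forces the only [Q i] to be [A]. *)
Definition block_decomposition A (t : nat) (Q : 'I_t -> {set P}) : Prop :=
  [/\ block_sum A Q,
      block A -> t = 1%N
    & ~ block A ->
        (2 <= t)%N /\
        forall (t' : nat) (Q' : 'I_t' -> {set P}),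
          (2 <= t')%N -> block_sum A Q' -> (t <= t')%N].

Definition in_A234 A : Prop := antichain A /\ #|A| \in [:: 2; 3; 4]%N.

Definition in_B A : Prop :=
  exists C T, [/\ disjoint_sum A C T, chain C, (2 <= #|C|)%N & #|T| = 1%N].

Definition is_Z A : Prop :=
  exists C T,
    [/\ disjoint_sum A C T, chain C, #|C| = 2%N, antichain T & #|T| = 2%N].

End Blocks.

Definition in_family {d : Order.disp_t} (P : finPOrderType d) : Prop :=
  forall (t : nat) (Q : 'I_t -> {set P}),
    block_decomposition [set: P] Q ->
    forall i : 'I_t, in_A234 (Q i) \/ in_B (Q i) \/ is_Z (Q i).

(* Main.v *)
Require Import Defs.
From mathcomp Require Import all_boot all_order.
From Stdlib Require Import Classical.

(* Call A compressible if it has an inclusion representation with fewer than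
   |A| labels. In a vertical sum labels add up, and compressing one summand
   compresses the whole, so everything reduces to vertical primes. An
   incompressible vertical prime A that is not a two-element antichain has a
   minimal element x such that A \ x has no least element; then one label
   suffices to insert x, so A \ x is again incompressible and, inductively, a
   vertical sum of good blocks. If that sum has at least two summands R < T,
   then x is incomparable to R, and labelling R by down-sets and T by
   complements of down-sets already places x, so A is compressible. Otherwise
   A \ x is a single good block, and each position of x relative to it yields
   either a good block or an explicit labelling with |A| - 1 labels. *)

Set Implicit Arguments.
Unset Strict Implicit.
Unset Printing Implicit Defensive.

Import Order.TTheory.

Ltac split_bools :=
  repeat match goal with
  | H : is_true (_ && _) |- _ =>
      let H1 := fresh in let H2 := fresh in case/andP: H => H1 H2
  end.

(** Evaluates comparisons in the goal from the hypotheses, consuming them, so that an order matrix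
    becomes a constant one. *)
Ltac rewrite_bools :=
  repeat match goal with
  | H : is_true (~~ _) |- _ => rewrite ?(negPf H); clear H
  | H : is_true (Order.le _ _) |- _ => rewrite ?H; clear H
  end.

(** * Exhaustive checks on short bit vectors *)

Section BitVectors.

(** Inclusion of sets given by characteristic vectors; [all2] leaves vectors of different lengths
    unrelated. *)
Definition bits_le : seq bool -> seq bool -> bool := all2 implb.

Definition bits_incomp u v := ~~ bits_le u v && ~~ bits_le v u.

Fixpoint bits n : seq (seq bool) :=
  if n is n'.+1 then [seq b :: v | b <- [:: true; false], v <- bits n'] else [:: [::]].

Lemma mem_bits v : v \in bits (size v).
Proof. by elim: v => // b v IH; apply/allpairsP; exists (b, v); case: b. Qed.

Lemma bits2_no_antichain3 : {in bits 2 & &, forall a b c,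
  ~~ [&& bits_incomp a b, bits_incomp a c & bits_incomp b c]}.
Proof.
have : all (fun a => all (fun b => all (fun c =>
    ~~ [&& bits_incomp a b, bits_incomp a c & bits_incomp b c])
  (bits 2)) (bits 2)) (bits 2) by vm_compute.
by move/allP=> h a b c aB bB cB; apply: (allP (allP (h a aB) b bB)).
Qed.

(* [a] and [b] are either incomparable or [a < b], so this covers both the
   four-element antichain and [Z]. *)
Lemma bits3_no_antichain4_or_Z a b c e :
    a \in bits 3 -> b \in bits 3 -> c \in bits 3 -> e \in bits 3 ->
  ~~ [&& ~~ bits_le b a, bits_incomp a c, bits_incomp a e, bits_incomp b c,
      bits_incomp b e & bits_incomp c e].
Proof.
have : all (fun a => all (fun b => all (fun c => all (fun e =>
    ~~ [&& ~~ bits_le b a, bits_incomp a c, bits_incomp a e, bits_incomp b c,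
        bits_incomp b e & bits_incomp c e])
  (bits 3)) (bits 3)) (bits 3)) (bits 3) by vm_compute.
by move/allP=> h aB bB cB eB; apply: (allP (allP (allP (h a aB) b bB) c cB) e eB).
Qed.

End BitVectors.

(** * Vocabulary: representations, compressibility, good sums *)

Section Dimension.
Local Open Scope order_scope.
Context {d : Order.disp_t} {P : finPOrderType d}.
Implicit Types (A B C R T : {set P}) (x y z : P).

Definition represents (U : finType) A (S : P -> {set U}) :=
  {in A &, forall x y, (x <= y) = (S x \subset S y)}.

Definition compressible A :=
  exists (U : finType) (S : P -> {set U}),
    represents A S /\ (#|\bigcup_(x in A) S x| < #|A|)%N.

Definition below A B := {in A & B, forall x y, x < y}.

(** Index-free form of a vertical sum of two parts; [splits_vertical_sum] gives the equivalence. *)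
Definition splits A :=
  exists A1 A2, [/\ A1 != set0, A2 != set0, A = A1 :|: A2 & below A1 A2].

Definition minimal_in A x := x \in A /\ {in A, forall y, y <= x -> y = x}.

Definition least_in A x := x \in A /\ {in A, forall y, x <= y}.

Definition good_block A := in_A234 A \/ in_B A \/ is_Z A.

(** Vertical sums of good blocks in binary form, which provides induction and inversion without
    indexed families. *)
Inductive good_sum : {set P} -> Prop :=
  | GoodBlock A : good_block A -> good_sum A
  | GoodSum A B : good_sum A -> good_sum B -> below A B -> good_sum (A :|: B).

Lemma incompF x y : x >< y -> ((x <= y) = false) * ((y <= x) = false).
Proof. by rewrite /Order.comparable negb_or => /andP[/negPf-> /negPf->]. Qed.

Lemma incompC x y : (x >< y) = (y >< x).
Proof. by rewrite comparable_sym. Qed.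

Lemma below_disjoint A B : below A B -> [disjoint A & B].
Proof.
move=> AB; rewrite -setI_eq0; apply/eqP/setP=> x; rewrite !inE.
by apply/negP=> /andP[xA xB]; have := AB x x xA xB; rewrite ltxx.
Qed.

Lemma card_below A B : below A B -> #|A :|: B| = (#|A| + #|B|)%N.
Proof.
by move/below_disjoint; rewrite -setI_eq0 cardsU => /eqP->; rewrite cards0 subn0.
Qed.

(** * Building representations with few labels *)

Lemma compressible_ground (U : finType) A (S : P -> {set U}) (G : {set U}) :
    represents A S -> {in A, forall x, S x \subset G} -> (#|G| < #|A|)%N ->
  compressible A.
Proof.
move=> rS SG ltG; exists U, S; split=> //; apply: leq_ltn_trans ltG.
by apply/subset_leq_card/bigcupsP.
Qed.

(** Elements of [B] receive all labels of [A] together with their down-sets in [B]. Down-sets are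
    non-empty, so no element of [B] falls below one of [A]. *)
Lemma compressible_below_l A B : below A B -> compressible A -> compressible (A :|: B).
Proof.
move=> AB [U [S [rS cS]]].
pose G := \bigcup_(x in A) S x.
have SG x : x \in A -> S x \subset G by move=> xA; apply: bigcup_sup.
pose S' x : {set U + P} :=
  if x \in A then inl @: S x else inl @: G :|: inr @: [set z in B | z <= x].
have inlI : injective (@inl U P) by move=> ? ? [].
have inrI : injective (@inr U P) by move=> ? ? [].
have lr (u : U) (K : {set P}) : (inl u \in inr @: K) = false.
  by apply/negP=> /imsetP[].
have rl (p : P) (K : {set U}) : (inr p \in inl @: K) = false.
  by apply/negP=> /imsetP[].
apply: (@compressible_ground _ _ S' (inl @: G :|: inr @: B)).
- move=> x y; rewrite !inE /S'.
  case: (boolP (x \in A)) => [xA _|xA /= xB]; case: (boolP (y \in A)) => [yA _|yA /= yB].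
  + rewrite rS //; apply/idP/idP=> [|/subsetP h]; first exact: imsetS.
    apply/subsetP=> u uS; have := h (inl u) (imset_f _ uS).
    by rewrite mem_imset.
  + rewrite (ltW (AB _ _ xA yB)); symmetry.
    by apply: subset_trans (subsetUl _ _); apply: imsetS; apply: SG.
  + rewrite (lt_geF (AB _ _ yA xB)); symmetry; apply/negP=> /subsetP/(_ (inr x)).
    by rewrite !inE !rl mem_imset // !inE xB lexx => /(_ isT).
  + apply/idP/idP=> [xy|/subsetP/(_ (inr x))].
      apply: setUS; apply: imsetS; apply/subsetP=> z; rewrite !inE => /andP[-> /=].
      by move=> /le_trans; apply.
    by rewrite !inE !rl !mem_imset // !inE xB lexx => /(_ isT).
- move=> x; rewrite !inE /S'; case: (boolP (x \in A)) => [xA _|xA /= xB].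
    by apply: subset_trans (subsetUl _ _); apply: imsetS; apply: SG.
  by apply: setUS; apply: imsetS; apply/subsetP=> z; rewrite inE => /andP[].
- rewrite card_below //; apply: (leq_ltn_trans (leq_card_setU _ _).1).
  by rewrite !card_imset // ltn_add2r.
Qed.

(** Here the sets representing [B] may be empty, so no element of [A] may carry all labels of [A].
    Complements of up-sets ensure this: [x] misses the label [x]. *)
Lemma compressible_below_r A B : below A B -> compressible B -> compressible (A :|: B).
Proof.
move=> AB [U [S [rS cS]]].
pose G := \bigcup_(x in B) S x.
have SG x : x \in B -> S x \subset G by move=> xA; apply: bigcup_sup.
pose S' x : {set U + P} :=
  if x \in A then inr @: [set z in A | ~~ (x <= z)] else inr @: A :|: inl @: S x.
have inlI : injective (@inl U P) by move=> ? ? [].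
have inrI : injective (@inr U P) by move=> ? ? [].
have lr (u : U) (K : {set P}) : (inl u \in inr @: K) = false.
  by apply/negP=> /imsetP[].
have rl (p : P) (K : {set U}) : (inr p \in inl @: K) = false.
  by apply/negP=> /imsetP[].
apply: (@compressible_ground _ _ S' (inr @: A :|: inl @: G)).
- move=> x y; rewrite !inE /S'.
  case: (boolP (x \in A)) => [xA _|xA /= xB]; case: (boolP (y \in A)) => [yA _|yA /= yB].
  + apply/idP/idP=> [xy|].
      apply: imsetS; apply/subsetP=> z; rewrite !inE => /andP[-> /=].
      by apply: contra; apply: le_trans.
    apply: contraTT => xy; apply/negP=> /subsetP/(_ (inr y)).
    by rewrite !mem_imset // !inE yA lexx xy => /(_ isT).
  + rewrite (ltW (AB _ _ xA yB)); symmetry.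
    apply: subset_trans (subsetUl _ _); apply: imsetS.
    by apply/subsetP=> z; rewrite inE => /andP[].
  + rewrite (lt_geF (AB _ _ yA xB)); symmetry; apply/negP=> /subsetP/(_ (inr y)).
    by rewrite !inE !mem_imset // !inE yA lexx => /(_ isT).
  + rewrite rS //; apply/idP/idP=> [h|/subsetP h]; first by apply: setUS; apply: imsetS.
    apply/subsetP=> u uS; have := h (inl u).
    by rewrite !inE !lr !mem_imset // uS => /(_ isT).
- move=> x; rewrite !inE /S'; case: (boolP (x \in A)) => [xA _|xA /= xB].
    apply: subset_trans (subsetUl _ _); apply: imsetS.
    by apply/subsetP=> z; rewrite inE => /andP[].
  by apply: setUS; apply: imsetS; apply: SG.
- rewrite card_below //; apply: (leq_ltn_trans (leq_card_setU _ _).1).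
  by rewrite !card_imset // ltn_add2l.
Qed.

(** One new label [None] marks the elements above [x], and [x] gets only that label. An element [y]
    whose set falls inside [{None}] has [S y] empty, so it would be least in [A :\ x]. *)
Lemma compressible_minimal A x :
    minimal_in A x -> ~ (exists m, least_in (A :\ x) m) ->
  compressible (A :\ x) -> compressible A.
Proof.
move=> [xA xmin] noleast [U [S [rS cS]]].
pose G := \bigcup_(y in A :\ x) S y.
have SG y : y \in A :\ x -> S y \subset G by move=> yA; apply: bigcup_sup.
have SomeI : injective (@Some U) by move=> ? ? [].
have NS (K : {set U}) : (None \in Some @: K) = false by apply/negP=> /imsetP[].
pose S' y : {set option U} :=
  if y == x then [set None] else
  Some @: S y :|: (if x <= y then [set None] else set0).
have NS' y : None \in S' y = (x <= y).
  rewrite /S'; case: eqP => [->|_]; first by rewrite inE lexx.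
  by rewrite inE NS; case: ifP; rewrite inE.
have SS' y u : Some u \in S' y = (y != x) && (u \in S y).
  rewrite /S'; case: eqP => [->|_]; first by rewrite inE.
  by rewrite inE mem_imset //; case: ifP; rewrite inE ?orbF.
apply: (@compressible_ground _ _ S' (None |: Some @: G)).
- move=> y z yA zA; case: (eqVneq y x) => [->|yx].
    rewrite {1}/S' eqxx sub1set; exact/esym/NS'.
  have yA' : y \in A :\ x by rewrite !inE yx.
  case: (eqVneq z x) => [->|zx].
    transitivity false; first by apply/negP=> /(xmin _ yA) yx'; rewrite yx' eqxx in yx.
    symmetry; apply/negP=> /subsetP h; case: noleast; exists y; split=> // z' z'A.
    rewrite rS //; apply/subsetP=> u uS; have := h (Some u).
    by rewrite !SS' yx uS eqxx => /(_ isT).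
  have zA' : z \in A :\ x by rewrite !inE zx.
  apply/idP/idP=> [yz|/subsetP h]; last first.
    rewrite rS //; apply/subsetP=> u uS; have := h (Some u).
    by rewrite !SS' yx zx uS => /(_ isT).
  apply/subsetP=> -[u|]; last by rewrite !NS' => /le_trans; apply.
  by rewrite !SS' yx zx /=; move: yz; rewrite rS // => /subsetP; apply.
- move=> y yA; apply/subsetP=> -[u|]; rewrite !inE //= SS' mem_imset //.
  by case/andP=> yx uy; apply/bigcupP; exists y => //; rewrite !inE yx.
- rewrite cardsU1 NS card_imset //= (cardsD1 x A) xA.
  by rewrite !add1n ltnS.
Qed.

(* Down-sets on [R] and complements of down-sets on [T] already separate [x],
   so [x] needs no label of its own. *)
Lemma compressible_minimal_below A R T x :
    minimal_in A x -> A :\ x = R :|: T -> below R T -> R != set0 ->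
    ~ (exists m, least_in T m) -> {in R, forall r, x >< r} ->
    (exists2 z, z \in T & ~~ (x <= z)) ->
  compressible A.
Proof.
move=> [xA xmin] AE RT /set0Pn[r0 r0R] noleast xR [z0 z0T xz0].
have xRT : x \notin R :|: T by rewrite -AE !inE eqxx.
have AP y : y \in A -> [\/ y = x, y \in R | y \in T].
  move=> yA; case: (eqVneq y x) => [->|yx]; first by constructor 1.
  have : y \in A :\ x by rewrite !inE yx.
  by rewrite AE inE => /orP[] h; [constructor 2 | constructor 3].
have RF y : y \in T -> y \in R = false.
  by move=> yT; apply/negP=> yR; have := RT y y yR yT; rewrite ltxx.
have xRF : x \in R = false by apply/negP=> xR'; rewrite inE xR' in xRT.
(* On [R] the labels form the down-set of [y]; on [T], for [y] outside [R], the complement of its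
   up-set. So [x] gets no label from [R], and from [T] exactly the labels not above it. *)
pose S y := [set u in R | u <= y] :|: [set u in T | (y \notin R) && ~~ (y <= u)].
have SR y u : u \in R -> u \in S y = (u <= y).
  by move=> uR; rewrite !inE uR; case: (boolP (u \in T)) => [/RF|]; rewrite ?uR //= orbF.
have ST y u : u \in T -> u \in S y = (y \notin R) && ~~ (y <= u).
  by move=> uT; rewrite !inE uT (RF _ uT).
have SE y u : u \in S y -> u \in R \/ u \in T.
  by rewrite !inE; case/orP=> /andP[uK _]; [left|right].
have Smono y z : y <= z -> S y \subset S z.
  move=> yz; apply/subsetP=> u uS; case: (SE _ _ uS) => uK; move: uS.
    by rewrite !SR // => /le_trans; apply.
  rewrite !ST // => /andP[yR yu]; apply/andP; split; last first.
    by apply: contra yu; apply: le_trans.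
  apply/negP=> zR; have zu := RT _ _ zR uK.
  by rewrite (le_trans yz (ltW zu)) in yu.
(* If [S y] lies in [S z], it has no label from [T], so all of [T] is above [y]. *)
have topF y z : y \in T -> z \in R -> ~~ (S y \subset S z).
  move=> yT zR; apply/negP=> /subsetP h; case: noleast; exists y; split=> // u uT.
  apply/negPn/negP=> yu; have := h u; rewrite !ST // zR RF //= yu.
  by move=> /(_ isT).
(* Every element other than [x] is above some [r] in [R] and carries the label [r], which [x]
   lacks. *)
have xF y : y \in A -> y != x -> ~~ (S y \subset S x).
  move=> yA yx; have : y \in R \/ y \in T.
    by case: (AP _ yA) => [yx'|->|->]; [rewrite yx' eqxx in yx|left|right].
  move=> yRT; apply/negP=> /subsetP h.
  have [r rR ry] : exists2 r, r \in R & r <= y.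
    by case: yRT => [yR|yT]; [exists y | exists r0 => //; apply/ltW/RT].
  have := h r; rewrite !SR // ry => /(_ isT) rx.
  by have := xR _ rR; rewrite incompC => /incompF; rewrite rx => -[].
apply: (@compressible_ground _ _ S (R :|: T)).
- move=> y z yA zA; apply/idP/idP; first exact: Smono.
  case: (eqVneq z x) => [->|zx].
    by case: (eqVneq y x) => [->//|yx] h; rewrite (negPf (xF _ yA yx)) in h.
  case: (AP _ zA) => [zx'|zR|zT]; first by rewrite zx' eqxx in zx.
    case: (AP _ yA) => [->|yR|yT].
    (* The label [z0] belongs to [S x] but to no set of an element of [R]. *)
    + move/subsetP/(_ z0); rewrite !ST // xRF xz0 zR //= => /(_ isT) //.
    + by move/subsetP/(_ y); rewrite !SR //; apply.
    + by move=> h; rewrite (negPf (topF _ _ yT zR)) in h.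
  apply: contraTT => yz; apply/negP=> /subsetP/(_ z); rewrite !ST // yz lexx andbF andbT.
  case: (boolP (y \in R)) => [yR|_]; last by move/(_ isT).
  by have := RT _ _ yR zT; move/ltW=> yz'; rewrite yz' in yz.
- by move=> y yA; apply/subsetP=> u /SE[] uK; rewrite inE uK ?orbT.
- by rewrite -AE (cardsD1 x A) xA add1n.
Qed.

(** Strict down-sets represent a chain, and the greatest element never occurs in them as a label. *)
Lemma compressible_chain A : A != set0 -> chain A -> compressible A.
Proof.
move=> /set0Pn[a0 a0A] cA.
pose S y := [set u in A | u < y].
have [m mA mP] : exists2 m, m \in A & {in A, forall y, y <= m}.
  case: (@arg_maxnP _ a0 (mem A) (fun y => #|S y|) a0A) => m mA' mP.
  have mA : m \in A := mA'.
  exists m => // y yA; have := cA _ _ yA mA.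
  case/orP=> //; rewrite le_eqVlt => /orP[/eqP->//|my].
  have := mP _ yA; rewrite /geq /= leqNgt => /negP[]; apply: proper_card.
  apply/properP; split; last by exists m; rewrite !inE ?ltxx ?my ?andbT ?andbF.
  by apply/subsetP=> z; rewrite !inE => /andP[-> /lt_trans]; apply.
apply: (@compressible_ground _ _ S (A :\ m)).
- move=> y z yA zA; apply/idP/idP=> [yz|].
    by apply/subsetP=> u; rewrite !inE => /andP[-> uy]; apply: lt_le_trans yz.
  apply: contraTT => yz; have := cA _ _ yA zA.
  rewrite /Order.comparable (negPf yz) /= => zy.
  apply/subsetP=> /(_ z); rewrite !inE zA ltxx /= lt_neqAle zy andbT.
  by case: eqP => [E|_ /(_ isT)//]; rewrite E lexx in yz.
- move=> y yA; apply/subsetP=> u; rewrite !inE => /andP[-> uy]; rewrite andbT.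
  by apply/eqP=> E; rewrite E in uy; have := mP _ yA; rewrite (lt_geF uy).
- by rewrite (cardsD1 m A) mA.
Qed.

(** Row [i] of [m] lists the labels of the [i]-th element of [s]. Comparing the order matrix with
    the inclusion matrix turns each explicit labelling into a computation. *)
Lemma compressible_enum A (s : seq P) (m : seq (seq nat)) w :
    uniq s -> A =i s -> size m = size s -> (w < size s)%N ->
    [seq [seq x <= y | y <- s] | x <- s] =
      [seq [seq all (mem l') l | l' <- m] | l <- m] ->
    all (all (fun k => k < w)%N) m ->
  compressible A.
Proof.
move=> us As sm ltw rel mw.
pose S y := [set k : 'I_w | (k : nat) \in nth [::] m (index y s)].
apply: (@compressible_ground _ _ S setT).
- move=> y z; rewrite !As => ys zs.
  have iy : (index y s < size s)%N by rewrite index_mem.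
  have iz : (index z s < size s)%N by rewrite index_mem.
  have := congr1 (fun r => nth false (nth [::] r (index y s)) (index z s)) rel.
  rewrite (nth_map y) // (nth_map y) // (nth_map [::]) ?sm // (nth_map [::]) ?sm //.
  rewrite !nth_index // => ->.
  apply/allP/subsetP=> [h k|h k ky]; first by rewrite !inE => /h.
  have my : nth [::] m (index y s) \in m by rewrite mem_nth ?sm.
  have kw := allP (allP mw _ my) _ ky.
  by have := h (Ordinal kw); rewrite !inE; apply.
- by move=> y _; apply: subsetT.
- by rewrite cardsT card_ord (eq_card As) (card_uniqP us).
Qed.

(** * Minimal elements and recognition of good blocks *)

Lemma exists_minimal A y : y \in A -> exists2 x, minimal_in A x & x <= y.
Proof.
move=> yA.
have Q0 : (y \in A) && (y <= y) by rewrite yA lexx.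
(* Among the elements below [y], one with the smallest down-set is minimal. *)
case: (@arg_minnP _ y [pred z | (z \in A) && (z <= y)]
         (fun z => #|[set u in A | u <= z]|) Q0) => x /andP[xA xy] xmin.
exists x => //; split=> // z zA zx; apply/eqP/negPn/negP=> zx'.
have zlt : z < x by rewrite lt_neqAle zx' zx.
have := xmin z; rewrite /= zA (le_trans zx xy) => /(_ isT); rewrite leqNgt => /negP[].
apply: proper_card; apply/properP; split.
  by apply/subsetP=> u; rewrite !inE => /andP[-> /le_trans]; apply.
by exists x; rewrite !inE xA ?lexx // lt_geF.
Qed.

Lemma chain_least C : chain C -> C != set0 -> exists m, least_in C m.
Proof.
move=> cC /set0Pn[c cIn]; have [m [mC mmin] _] := exists_minimal cIn.
exists m; split=> // y yC; case/orP: (cC _ _ mC yC) => // /(mmin _ yC) ->.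
exact: lexx.
Qed.

(** On an explicit list this unfolds to the negated comparisons that [rewrite_bools] consumes. *)
Definition discrete : seq P -> bool :=
  pairwise (fun y z : P => ~~ (y <= z) && ~~ (z <= y)).

Lemma antichain_discrete B (s : seq P) :
  antichain B -> {subset s <= B} -> uniq s -> discrete s.
Proof.
move=> aB; elim: s => //= y s IH sB /andP[ys us].
rewrite IH ?andbT //; last by move=> z zs; apply: sB; rewrite inE zs orbT.
apply/allP=> z zs; have zy : y != z by apply: contraNneq ys => ->.
have yB : y \in B by apply: sB; rewrite mem_head.
have zB : z \in B by apply: sB; rewrite inE zs orbT.
by rewrite !(incompF (aB _ _ yB zB zy)).
Qed.

Lemma incompI x y : ~~ (x <= y) -> ~~ (y <= x) -> x >< y.
Proof. by rewrite /Order.comparable negb_or => -> ->. Qed.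

Lemma chain_pair x y : x <= y -> chain [set x; y].
Proof.
move=> xy u v; rewrite !inE => /orP[]/eqP-> /orP[]/eqP->; rewrite ?comparablexx //.
  exact: le_comparable.
by rewrite comparable_sym le_comparable.
Qed.

Lemma incomparable_neq x y : x >< y -> x != y.
Proof. by apply: contraNneq => ->; rewrite comparablexx. Qed.

Lemma in_B_intro B C t :
    B = C :|: [set t] -> chain C -> (1 < #|C|)%N -> {in C, forall c, c >< t} ->
  in_B B.
Proof.
move=> BE cC C2 Ct; exists C, [set t]; split=> //; last exact: cards1.
split=> //; last by move=> c u cC' /set1P->; apply: Ct.
rewrite -setI_eq0; apply/eqP/setP=> u; rewrite !inE.
by apply/negP=> /andP[uC /eqP E]; have := incomparable_neq (Ct _ uC); rewrite E eqxx.
Qed.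

Lemma is_Z_intro B C u v :
    B = C :|: [set u; v] -> chain C -> #|C| = 2 -> {in C, forall c, c >< u} ->
    {in C, forall c, c >< v} -> u >< v ->
  is_Z B.
Proof.
move=> BE cC C2 Cu Cv uv; exists C, [set u; v].
have uv' := incomparable_neq uv.
split=> //; last by rewrite cards2 uv'.
  split=> //; last by move=> c w cC' /set2P[]->; [apply: Cu | apply: Cv].
  rewrite -setI_eq0; apply/eqP/setP=> w; rewrite !inE.
  apply/negP=> /andP[wC /orP[]/eqP E].
    by have := incomparable_neq (Cu _ wC); rewrite E eqxx.
  by have := incomparable_neq (Cv _ wC); rewrite E eqxx.
by move=> y z /set2P[]-> /set2P[]->; rewrite ?eqxx // incompC.
Qed.

(** * Adding a minimal element to a single good block *)

Lemma extend_antichain A x :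
    minimal_in A x -> in_A234 (A :\ x) -> ~ least_in A x ->
  good_block A \/ compressible A.
Proof.
move=> [xA xmin] [aB cB] nl.
have xF y : y \in A :\ x -> ~~ (y <= x).
  rewrite !inE => /andP[yx yA]; apply: contra yx => /(xmin _ yA) ->.
  exact: eqxx.
have cA : #|A| = #|A :\ x|.+1 by rewrite (cardsD1 x A) xA.
case: (boolP [exists a in A :\ x, x <= a]) => [/exists_inP[a aB' xa]|]; last first.
  rewrite negb_exists_in => /forall_inP h.
  have aA : antichain A.
    move=> y z yA zA yz; rewrite /Order.comparable negb_or.
    case: (eqVneq y x) yz => [-> xz|yx yz].
      have zB : z \in A :\ x by rewrite !inE eq_sym xz.
      by rewrite h ?xF.
    have yB : y \in A :\ x by rewrite !inE yx.
    case: (eqVneq z x) => [->|zx]; first by rewrite h ?xF.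
    have zB : z \in A :\ x by rewrite !inE zx.
    by have := aB _ _ yB zB yz => /incompF[-> ->].
  move: cB; rewrite !inE => /or3P[]/eqP c; rewrite c in cA.
  - by left; left; split=> //; rewrite cA.
  - by left; left; split=> //; rewrite cA.
  right; have us := enum_uniq A; have ss : size (enum A) = 5 by rewrite -cardE.
  have As : A =i enum A by move=> y; rewrite mem_enum.
  have pw : discrete (enum A).
    by apply: antichain_discrete aA _ us => y; rewrite mem_enum.
  move: (enum A) us ss As pw => [|a1 [|a2 [|a3 [|a4 [|a5 [|? ?]]]]]] us // _ As pw.
  (* An antichain of five: five of the six two-element subsets of four labels. *)
  apply: (@compressible_enum _ _
    [:: [:: 0; 1]; [:: 0; 2]; [:: 0; 3]; [:: 1; 2]; [:: 1; 3]]%N 4 us As) => //.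
  rewrite /discrete /= in pw; split_bools; rewrite /= !lexx.
  by rewrite_bools.
have [dd dB xd] : exists2 dd, dd \in A :\ x & ~~ (x <= dd).
  apply: NNPP => h; apply: nl; split=> // y yA.
  case: (eqVneq y x) => [->|yx]; first exact: lexx.
  by apply/negPn/negP=> xy; apply: h; exists y; rewrite ?inE ?yx.
have ad : dd != a by apply: contraNneq xd => ->.
have xa' : a != x by move: aB'; rewrite !inE => /andP[].
have xd' : dd != x by move: dB; rewrite !inE => /andP[].
pose K := A :\ x :\ a :\ dd; pose s := enum K.
have dBa : dd \in A :\ x :\ a by rewrite in_setD1 ad.
have cK : #|A :\ x| = #|K|.+2.
  by rewrite (cardsD1 a (A :\ x)) aB' (cardsD1 dd (A :\ x :\ a)) dBa.
have us : uniq [:: x, a, dd & s].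
  rewrite /= !inE !mem_enum enum_uniq !inE !eqxx /= !andbF andbT.
  by rewrite eq_sym (negPf xa') eq_sym (negPf xd') eq_sym (negPf ad).
have As : A =i [:: x, a, dd & s].
  move=> y; rewrite !inE mem_enum !inE; case: (eqVneq y x) => [->|] //=.
  move=> yx; case: (eqVneq y a) => [->|] /=; first by move: aB'; rewrite inE => /andP[].
  by move=> ya; case: (eqVneq y dd) => [->|] //=; move: dB; rewrite inE => /andP[].
have sz : size s = #|K| by rewrite -cardE.
have pw : discrete [:: a, dd & s].
  apply: antichain_discrete aB _ _; last by case/andP: us.
  move=> y; rewrite !inE => /or3P[/eqP->|/eqP->|]; first by rewrite -in_setD1.
    by rewrite -in_setD1.
  by rewrite mem_enum !inE => /and4P[_ _ -> ->].
have pF : all (fun y => ~~ (y <= x)) [:: a, dd & s].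
  rewrite /= !xF //=; apply/allP=> y; rewrite mem_enum => /setD1P[_ /setD1P[_]].
  exact: xF.
(* The antichain has at most four elements, two of which are [a] (above [x]) and [dd] (not above
   [x]). *)
have sz3 : (size s < 3)%N.
  by move: cB; rewrite sz cK !inE !eqSS => /or3P[]/eqP->.
move: sz3 us As pw pF; rewrite /discrete.
case: s {sz} => [|b [|c [|? ?]]] //= _ us As pw pF.
- left; right; left; apply: (@in_B_intro _ [set x; a] dd).
  + by apply/setP=> y; rewrite As !inE orbA.
  + exact: chain_pair.
  + by rewrite cards2 eq_sym xa'.
  + by move=> y; split_bools => /set2P[]->; apply: incompI.
- case: (boolP (x <= b)) => xb.
    right; apply: (@compressible_enum _ [:: x; a; dd; b]
      [:: [:: 0]; [:: 0; 1]; [:: 1; 2]; [:: 0; 2]]%N 3 us As) => //.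
    by split_bools; rewrite /= !lexx; rewrite_bools.
  left; right; right; apply: (@is_Z_intro _ [set x; a] dd b).
  + by apply/setP=> y; rewrite As !inE !orbA.
  + exact: chain_pair.
  + by rewrite cards2 eq_sym xa'.
  + by move=> y; split_bools => /set2P[]->; apply: incompI.
  + by move=> y; split_bools => /set2P[]->; apply: incompI.
  + by split_bools; apply: incompI.
(* Besides [{0,1}] and [{2,3}] the pairs from four labels form two complementary couples; [b] and
   [c] each take from their own couple the pair that contains [0] exactly when they are above
   [x]. *)
- right; apply: (@compressible_enum _ [:: x; a; dd; b; c]
      [:: [:: 0%N]; [:: 0%N; 1%N]; [:: 2; 3]%N;
          if x <= b then [:: 0; 2]%N else [:: 1; 3]%N;
          if x <= c then [:: 0; 3]%N else [:: 1; 2]%N] 4 us As) => //.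
    split_bools; rewrite /= !lexx.
    by case: (boolP (x <= b)) => ?; case: (boolP (x <= c)) => ?; rewrite_bools.
  by case: ifP; case: ifP.
Qed.

(** Chain elements keep their down-sets, which all contain the bottom [c1]; as [X] and [Y] avoid
    [c1], no chain set lies in them. As [t] is in [Y], neither does [Y] lie in a chain set. The
    remaining conditions place [X] relative to the others. *)
Lemma compressible_chain_plus A C x t c1 (X Y : {set P}) :
    x \in A -> A :\ x = C :|: [set t] -> chain C -> least_in C c1 ->
    {in C, forall c, c >< t} -> {in A :\ x, forall y, ~~ (y <= x)} ->
    X \subset C :|: [set t] -> Y \subset C :|: [set t] -> t \in Y ->
    c1 \notin X -> c1 \notin Y -> ~~ (Y \subset X) ->
    (X \subset Y) = (x <= t) ->
    {in C, forall c, (X \subset [set u in C | u <= c]) = (x <= c)} ->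
  compressible A.
Proof.
move=> xA AE cC [c1C c1min] Ct xmin XA YA tY c1X c1Y YX XY XC.
have tC : t \in C = false.
  by apply/negP=> tC; have := incomparable_neq (Ct _ tC); rewrite eqxx.
have xCt : x \in C :|: [set t] = false by rewrite -AE !inE eqxx.
have xC : x \in C = false by move: xCt; rewrite inE => /norP[/negPf].
have tx : t == x = false by move: xCt; rewrite !inE eq_sym => /norP[_ /negPf].
pose S y := if y == x then X else if y == t then Y else [set u in C | u <= y].
have Sx : S x = X by rewrite /S eqxx.
have St : S t = Y by rewrite /S tx eqxx.
have SC y : y \in C -> S y = [set u in C | u <= y].
  move=> yC; rewrite /S; case: eqP => [E|_]; first by rewrite -E yC in xC.
  by case: eqP => [E|_] //; rewrite -E yC in tC.
have AP y : y \in A -> [\/ y = x, y = t | y \in C].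
  move=> yA; case: (eqVneq y x) => [|yx]; first by constructor 1.
  have : y \in A :\ x by rewrite !inE yx.
  by rewrite AE !inE => /orP[yC|/eqP yt]; [constructor 3 | constructor 2].
have xmint : t <= x = false by apply: negbTE; apply: xmin; rewrite AE !inE eqxx orbT.
have xminC c : c \in C -> c <= x = false.
  by move=> cC'; apply: negbTE; apply: xmin; rewrite AE !inE cC'.
have c1F c (K : {set P}) :
    c \in C -> c1 \notin K -> [set u in C | u <= c] \subset K = false.
  move=> cC'; apply: contraNF => /subsetP; apply; rewrite inE c1C; exact: c1min.
apply: (@compressible_ground _ _ S (C :|: [set t])).
- move=> y z /AP[->|->|yC] /AP[->|->|zC]; rewrite ?Sx ?St ?(SC _ yC) ?(SC _ zC).
  + by rewrite lexx subxx.
  + by rewrite XY.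
  + by rewrite XC.
  + by rewrite xmint (negPf YX).
  + by rewrite lexx subxx.
  + rewrite (incompF (Ct _ zC)); symmetry; apply/negP=> /subsetP/(_ t tY).
    by rewrite inE tC.
  + by rewrite xminC // c1F.
  + by rewrite (incompF (Ct _ yC)) c1F.
  + apply/idP/idP=> [yz|/subsetP/(_ y)]; last by rewrite !inE yC lexx => /(_ isT).
    by apply/subsetP=> u; rewrite !inE => /andP[-> /le_trans]; apply.
- move=> y /AP[->|->|yC]; rewrite ?Sx ?St ?(SC _ yC) //.
  by apply: subset_trans (subsetUl _ _); apply/subsetP=> u; rewrite inE => /andP[].
- by rewrite -AE (cardsD1 x A) xA.
Qed.

Lemma extend_chain_plus A x :
    minimal_in A x -> in_B (A :\ x) -> ~ least_in A x ->
  good_block A \/ compressible A.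
Proof.
move=> [xA xmin] [C [T [[AE _ CT] cC C2 /eqP/cards1P[t Tt]]]] nl; subst T.
have Ct : {in C, forall c, c >< t} by move=> c cC'; apply: CT; rewrite ?inE.
have tC : t \in C = false.
  by apply/negP=> tC; have := incomparable_neq (Ct _ tC); rewrite eqxx.
have xF y : y \in A :\ x -> ~~ (y <= x).
  rewrite !inE => /andP[yx yA]; apply: contra yx => /(xmin _ yA) ->.
  exact: eqxx.
have xmint : ~~ (t <= x) by apply/xF; rewrite AE !inE eqxx orbT.
have xminC c : c \in C -> ~~ (c <= x).
  by move=> cC'; apply/xF; rewrite AE !inE cC'.
have AxE : A = x |: (C :|: [set t]) by rewrite -AE setD1K.
have xC : x \notin C.
  by apply/negP=> xC; have := setD11 x A; rewrite AE inE xC.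
have [c1 c1l] : exists m, least_in C m.
  by apply: chain_least cC _; apply: contraTneq C2 => ->; rewrite cards0.
have [c1C c1min] := c1l.
have c1t : c1 != t by apply: contraTneq c1C => ->; rewrite tC.
have CD : #|C| = #|C :\ c1|.+1 by rewrite (cardsD1 c1 C) c1C.
have CP X Y := @compressible_chain_plus A C x t c1 X Y xA AE cC c1l Ct xF.
have sub1 y : y \in C -> [set y] \subset C :|: [set t].
  by move=> yC; rewrite sub1set inE yC.
have subt : [set t] \subset C :|: [set t] by apply: subsetUr.
have sub2 y : y \in C -> [set y; t] \subset C :|: [set t].
  by move=> yC; rewrite subUset sub1 ?subt.
have noC (X : {set P}) c : t \in X -> X \subset [set u in C | u <= c] = false.
  by move=> tX; apply/negP=> /subsetP/(_ t tX); rewrite inE tC.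
case: (boolP [exists c in C, x <= c]) => [/exists_inP[c cIn xc]|]; last first.
  rewrite negb_exists_in => /forall_inP h.
  (* With [x] below no chain element, [X] contains [t] and so lies in no chain set; [p] is a label
     other than [c1], put into [Y] but not into [X]. *)
  have [p pC pc1] : exists2 p, p \in C & p != c1.
    have /card_gt0P[p] : (0 < #|C :\ c1|)%N by rewrite -ltnS -CD.
    by rewrite !inE => /andP[pc1 pC]; exists p.
  have pt : p != t by apply: contraTneq pC => ->; rewrite tC.
  case: (boolP (x <= t)) => xt.
    right; apply: (CP [set t] [set p; t]); rewrite ?sub2 ?subt ?xt // ?inE ?eqxx ?orbT //.
    + by rewrite negb_or eq_sym pc1.
    + by rewrite subUset !sub1set !inE (negPf pt).
    + by rewrite sub1set !inE eqxx orbT.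
    + by move=> e eC; rewrite noC ?inE ?eqxx // (negPf (h _ eC)).
  have [C2'|C3] := eqVneq #|C| 2.
    left; right; right; apply: (@is_Z_intro _ C t x) => //.
    + by apply/setP=> u; rewrite AxE !inE orbC -orbA.
    + by move=> e eC; apply: incompI; rewrite ?h ?xminC.
    + exact: incompI.
  (* A chain of three or more elements has a second spare label [q], and [{q, t}] and [{p, t}] are
     incomparable. *)
  have [q qC /andP[qc1 qp]] : exists2 q, q \in C & (q != c1) && (q != p).
    have /card_gt0P[q] : (0 < #|C :\ c1 :\ p|)%N.
      have := cardsD1 p (C :\ c1); rewrite !inE pc1 pC /=.
      by move: C2 C3; rewrite CD; case: #|_ :\ p| => // C2 + E; rewrite E.
    by rewrite !inE => /and3P[qp qc1 qC]; exists q => //; rewrite qc1.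
  have qt : q != t by apply: contraTneq qC => ->; rewrite tC.
  right; apply: (CP [set q; t] [set p; t]); rewrite ?sub2 // ?inE ?eqxx ?orbT //.
  + by rewrite negb_or eq_sym qc1.
  + by rewrite negb_or eq_sym pc1.
  + by rewrite subUset !sub1set !inE (negPf pt) eq_sym (negPf qp).
  + by rewrite subUset !sub1set !inE (negPf qt) (negPf qp) (negPf xt).
  + by move=> e eC; rewrite noC ?inE ?eqxx ?orbT // (negPf (h _ eC)).
(* [cj] is the least chain element above [x], so [{cj}] lies in the down-set of [e] exactly when
   [x <= e]. *)
have [cj [[cjC xcj] cjmin]] : exists cj, (cj \in C /\ x <= cj) /\
    {in C, forall e, x <= e -> cj <= e}.
  have [||m [mW mmin]] := @chain_least [set e in C | x <= e].
  - by move=> u v; rewrite !inE => /andP[uC _] /andP[vC _]; apply: cC.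
  - by apply/set0Pn; exists c; rewrite inE cIn.
  move: mW; rewrite inE => /andP[mC xm]; exists m; split=> // e eC xe.
  by apply: mmin; rewrite inE eC.
have cjt : cj != t by apply: contraTneq cjC => ->; rewrite tC.
have XC e : e \in C -> ([set cj] \subset [set u in C | u <= e]) = (x <= e).
  move=> eC; rewrite sub1set inE cjC /=.
  by apply/idP/idP=> [|/(cjmin _ eC)//]; apply: le_trans.
(* If [cj] is the bottom, [x] prolongs the chain downwards; [t] stays incomparable to it because [x]
   is not least in [A]. *)
case: (eqVneq cj c1) => [E|cj1].
  have xc1 e : e \in C -> x <= e.
    by move=> eC; apply: le_trans xcj _; rewrite E; apply: c1min.
  left; right; left; apply: (@in_B_intro _ (x |: C) t).
  + by rewrite AxE setUA.
  + move=> u v; rewrite !inE => /orP[/eqP->|uC] /orP[/eqP->|vC]; rewrite ?comparablexx //.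
    * by apply/le_comparable/xc1.
    * by rewrite comparable_sym; apply/le_comparable/xc1.
    * exact: cC.
  + by rewrite cardsU1 xC CD.
  + move=> u; rewrite !inE => /orP[/eqP->|]; last exact: Ct.
    apply: incompI => //; apply/negP=> xt; apply: nl; split=> // y.
    by rewrite AxE !inE => /or3P[/eqP->|/xc1|/eqP->].
(* Otherwise [{cj}] avoids [c1] and serves as [X]; [cj] is added to [Y] exactly when [x <= t]. *)
right; case: (boolP (x <= t)) => xt.
  apply: (CP [set cj] [set cj; t]); rewrite ?sub1 ?sub2 // ?inE ?eqxx ?orbT //.
  + by rewrite eq_sym.
  + by rewrite negb_or eq_sym cj1.
  + by rewrite subUset !sub1set !inE eqxx eq_sym (negPf cjt).
  + by rewrite sub1set !inE eqxx xt.
apply: (CP [set cj] [set t]); rewrite ?subt ?sub1 // ?inE ?eqxx ?orbT //.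
+ by rewrite eq_sym.
+ by rewrite sub1set !inE eq_sym.
+ by rewrite sub1set !inE (negPf xt) (negPf cjt).
Qed.

Lemma extend_Z A x :
  minimal_in A x -> is_Z (A :\ x) -> ~ least_in A x -> compressible A.
Proof.
move=> [xA xmin] [C [T [[AE _ CT] cC C2 aT T2]]] nl.
have /cards2P[a' [b' [ab' CE]]] : #|C| == 2%N by apply/eqP.
have /cards2P[c [e [ce TE]]] : #|T| == 2%N by apply/eqP.
subst C T.
have [a [b [ab ab2 CE]]] : exists a b, [/\ a != b, a <= b & [set a'; b'] = [set a; b]].
  have /orP[h|h] : a' >=< b' by apply: cC; rewrite !inE eqxx ?orbT.
    by exists a', b'.
  by exists b', a'; rewrite eq_sym setUC.
rewrite {}CE in AE CT cC.
have xF y : y \in A :\ x -> y <= x = false.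
  by rewrite !inE => /andP[yx yA]; apply: contraNF yx => /(xmin _ yA) ->.
have [ac ae] : a >< c /\ a >< e by split; apply: CT; rewrite !inE eqxx ?orbT.
have [bc be] : b >< c /\ b >< e by split; apply: CT; rewrite !inE eqxx ?orbT.
have ce' : c >< e by apply: aT; rewrite ?inE ?eqxx ?orbT.
have ba : b <= a = false by rewrite lt_geF // lt_neqAle ab.
have As : A =i [:: x; a; b; c; e].
  by move=> y; rewrite -(setD1K xA) AE !inE !orbA.
have ac' := incomparable_neq ac; have ae' := incomparable_neq ae.
have bc' := incomparable_neq bc; have be' := incomparable_neq be.
have us : uniq [:: x; a; b; c; e].
  have : x \notin A :\ x by rewrite !inE eqxx.
  rewrite AE /= !inE !negb_or => /andP[/andP[-> ->] /andP[-> ->]].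
  by rewrite ab ac' ae' bc' be' ce.
(* Rows and columns run over [x], [a], [b], [c], [e]; minimality of [x] fixes the first column, so
   only the first row varies. *)
have K m : size m = 5 -> all (all (fun k => k < 4)%N) m ->
    [:: [:: true; x <= a; x <= b; x <= c; x <= e];
        [:: false; true; true; false; false];
        [:: false; false; true; false; false];
        [:: false; false; false; true; false];
        [:: false; false; false; false; true]] =
      [seq [seq all (mem l') l | l' <- m] | l <- m] -> compressible A.
  move=> sm mw E; apply: (compressible_enum us As sm _ _ mw) => //.
  rewrite /= !lexx ab2 ba !(incompF ac) !(incompF ae) !(incompF bc) !(incompF be).
  by rewrite !(incompF ce') !xF ?AE ?inE ?eqxx ?orbT.
have xab : x <= a -> x <= b by move=> /le_trans; apply.
have nl' : ~~ [&& x <= a, x <= b, x <= c & x <= e].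
  apply/negP=> /and4P[? ? ? ?]; apply: nl; split=> // y.
  by rewrite As !inE => /orP[|/orP[|/orP[|/orP[]]]]/eqP->.
(* Eleven first rows remain: three with [x <= a], which forces [x <= b], and eight without. *)
case: (x <= a) xab nl' K => [/(_ isT) ->|_].
  case: (x <= c); case: (x <= e) => // _ K.
  - exact: (K [:: [:: 0]; [:: 0; 1]; [:: 0; 1; 2]; [:: 0; 3]; [:: 1; 3]]%N).
  - exact: (K [:: [:: 0]; [:: 0; 1]; [:: 0; 1; 2]; [:: 1; 3]; [:: 0; 3]]%N).
  - exact: (K [:: [:: 0]; [:: 0; 1]; [:: 0; 1; 2]; [:: 1; 3]; [:: 2; 3]]%N).
case: (x <= b); case: (x <= c); case: (x <= e) => // _ K.
- exact: (K [:: [:: 1]; [:: 0]; [:: 0; 1]; [:: 1; 2]; [:: 1; 3]]%N).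
- exact: (K [:: [:: 1]; [:: 0]; [:: 0; 1]; [:: 1; 2]; [:: 2; 3]]%N).
- exact: (K [:: [:: 1]; [:: 0]; [:: 0; 1]; [:: 2; 3]; [:: 1; 2]]%N).
- exact: (K [:: [:: 1]; [:: 0]; [:: 0; 1]; [:: 2]; [:: 3]]%N).
- exact: (K [:: [:: 2]; [:: 0]; [:: 0; 1]; [:: 2; 3]; [:: 1; 2]]%N).
- exact: (K [:: [:: 2]; [:: 0]; [:: 0; 1]; [:: 2; 3]; [:: 1; 3]]%N).
- exact: (K [:: [:: 2]; [:: 0]; [:: 0; 1]; [:: 1; 3]; [:: 2; 3]]%N).
- exact: (K [:: [:: 1; 2]; [:: 0]; [:: 0; 1]; [:: 1; 3]; [:: 2; 3]]%N).
Qed.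

(** * Size of good blocks and absence of least elements *)

Lemma good_block_card B : good_block B -> (1 < #|B|)%N.
Proof.
case=> [[_]|[[C [T [[BE _ _] _ C2 _]]]|[C [T [[BE _ _] _ C2 _ _]]]]].
- by rewrite !inE => /or3P[]/eqP->.
- by rewrite BE (leq_trans C2) // subset_leq_card // subsetUl.
- by rewrite BE -C2 subset_leq_card // subsetUl.
Qed.

(** In an antichain of at least two elements, as in a disjoint sum of two non-empty parts, every
    element is incomparable to another one. *)
Lemma good_block_no_least B m : good_block B -> ~ least_in B m.
Proof.
move=> gB [mB mmin].
have two (D : {set P}) : (1 < #|D|)%N -> exists2 y : P, y \in D & y != m.
  move=> D2; have /card_gt0P[y] : (0 < #|D :\ m|)%N.
    by move: D2; rewrite (cardsD1 m D); case: (m \in D) => //; apply: ltnW.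
  by rewrite !inE => /andP[ym yD]; exists y.
have dis C T : disjoint_sum B C T -> C != set0 -> T != set0 -> False.
  move=> [BE _ CT] /set0Pn[c cC] /set0Pn[t tT].
  have tB : t \in B by rewrite BE inE tT orbT.
  have cB : c \in B by rewrite BE inE cC.
  move: (mB); rewrite BE inE => /orP[mK|mK].
    by have := CT _ _ mK tT => /incompF; rewrite mmin // => -[].
  by have := CT _ _ cC mK => /incompF; rewrite mmin // => -[].
have B2 := good_block_card gB.
case: gB => [[aB _]|[[C [T [h _ C2 T1]]]|[C [T [h _ C2 _ T2]]]]].
- have [y yB ym] := two _ B2.
  by have := aB _ _ yB mB ym => /incompF; rewrite mmin // => -[].
- by apply: (dis _ _ h); apply/set0Pn/card_gt0P; rewrite ?T1 // (leq_trans _ C2).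
- by apply: (dis _ _ h); apply/set0Pn/card_gt0P; rewrite ?T2 ?C2.
Qed.

Lemma good_sum_n0 B : good_sum B -> B != set0.
Proof.
elim=> [A /good_block_card A1|A C _ A0 _ _ _].
  by rewrite -card_gt0 (ltnW A1).
by rewrite -subset0 subUset !subset0 (negPf A0).
Qed.

Lemma good_sum_no_least B m : good_sum B -> ~ least_in B m.
Proof.
elim=> [A gA|A C gA IHA gC IHC AC [mAC mmin]]; first exact: good_block_no_least.
apply: IHA; have /set0Pn[a aA] := good_sum_n0 gA.
have ma : m <= a by apply: mmin; rewrite inE aA.
split=> [|y yA]; last by apply: mmin; rewrite inE yA.
move: mAC; rewrite inE => /orP[//|mC].
by have := lt_le_trans (AC _ _ aA mC) ma; rewrite ltxx.
Qed.

(** * Incompressible sets are good sums *)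

Lemma least_splits A m : (1 < #|A|)%N -> least_in A m -> splits A.
Proof.
move=> A2 [mA mmin]; exists [set m], (A :\ m); split.
- by apply/set0Pn; exists m; rewrite inE.
- by rewrite -card_gt0; move: A2; rewrite (cardsD1 m A) mA.
- by rewrite setD1K.
- move=> u v /set1P-> /setD1P[vm vA]; rewrite lt_neqAle eq_sym vm; exact: mmin.
Qed.

(** Without a least element there are two minimal elements [m1] and [m2]. If every such removal left
    a least element, both would be below all the rest, so [A] would be a two-element antichain or
    would split. *)
Lemma exists_removable A :
    (1 < #|A|)%N -> ~ splits A -> ~ good_block A ->
  exists x, minimal_in A x /\ ~ (exists m, least_in (A :\ x) m).
Proof.
move=> A2 ns nb.
have nl m : ~ least_in A m by move/(least_splits A2).
have /card_gt0P[y0 y0A] := ltnW A2.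
have [m1 m1min _] := exists_minimal y0A; have m1A := m1min.1.
have [y yA ym1] : exists2 y, y \in A & ~~ (m1 <= y).
  apply: NNPP => h; apply: (nl m1); split=> // y yA.
  by apply/negPn/negP=> ?; apply: h; exists y.
have [m2 m2min m2y] := exists_minimal yA; have m2A := m2min.1.
have m12 : ~~ (m1 <= m2) by apply: contra ym1 => /le_trans; apply.
have m21 : ~~ (m2 <= m1).
  by apply: contraNN m12 => /(m1min.2 _ m2A) ->; rewrite lexx.
have neq : m1 != m2 by apply: contraNneq m12 => ->.
apply: NNPP => none.
(* The least element of [A :\ u] lies below the minimal element [v], hence is [v]. *)
have above u v :
    minimal_in A u -> minimal_in A v -> u != v -> {in A :\ u, forall z, v <= z}.
  move=> umin vmin uv.
  have [w [wA wl]] : exists w, least_in (A :\ u) w.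
    by apply: NNPP => h; apply: none; exists u.
  have wv : w <= v by apply: wl; rewrite !inE eq_sym uv vmin.1.
  have := vmin.2 w; case/setD1P: wA => _ wA' /(_ wA' wv) <-; exact: wl.
have ab1 := above _ _ m1min m2min neq.
rewrite eq_sym in neq; have ab2 := above _ _ m2min m1min neq.
have AE : A = [set m1; m2] :|: (A :\ m1 :\ m2).
  by rewrite -setUA setD1K ?setD1K // !inE neq.
have [E|n0] := eqVneq (A :\ m1 :\ m2) set0.
  apply: nb; left; rewrite AE E setU0; split; last by rewrite cards2 eq_sym neq.
  by move=> u v /set2P[]-> /set2P[]->; rewrite ?eqxx // => _; apply: incompI.
apply: ns; exists [set m1; m2], (A :\ m1 :\ m2); split=> //.
  by apply/set0Pn; exists m1; rewrite !inE eqxx.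
move=> u v /set2P[]-> /setD1P[v2 /setD1P[v1 vA]]; rewrite lt_neqAle eq_sym ?v1 ?v2 /=.
  by apply: ab2; rewrite !inE v2.
by apply: ab1; rewrite !inE v1.
Qed.

Lemma incompressible_good_sum A :
  A != set0 -> ~ compressible A -> good_sum A.
Proof.
have [n] := ubnP #|A|; elim: n A => // n IH A ltn A0 nc.
case: (classic (good_block A)) => [|nb]; first exact: GoodBlock.
case: (classic (splits A)) => [[A1 [A2 [A10 A20 AE lt12]]]|ns].
  have cA : #|A| = (#|A1| + #|A2|)%N by rewrite AE card_below.
  rewrite -card_gt0 in A10; rewrite -card_gt0 in A20.
  rewrite AE; apply: GoodSum => //; apply: IH; rewrite -?card_gt0 //.
  - by apply: leq_trans (ltn : (#|A| <= n)%N); rewrite cA -addn1 leq_add2l.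
  - by move=> c; apply: nc; rewrite AE; apply: compressible_below_l.
  - by apply: leq_trans (ltn : (#|A| <= n)%N); rewrite cA -add1n leq_add2r.
  - by move=> c; apply: nc; rewrite AE; apply: compressible_below_r.
case: (ltnP 1 #|A|) => [A2|A1]; last first.
  case: nc; apply: compressible_chain => // u v uA vA.
  have /cards1P[w AE] : #|A| == 1%N by rewrite eqn_leq A1 card_gt0.
  by move: uA vA; rewrite AE !inE => /eqP-> /eqP->; rewrite comparablexx.
have [x [xmin nl]] := exists_removable A2 ns nb.
have xA := xmin.1.
have nlx : ~ least_in A x by move/(least_splits A2).
have cA : #|A| = #|A :\ x|.+1 by rewrite (cardsD1 x A) xA.
have gs : good_sum (A :\ x).
  apply: IH; first by rewrite -cA.
  - by rewrite -card_gt0; move: A2; rewrite cA.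
  - by move=> c; apply: nc; apply: compressible_minimal c.
case E: _ / gs => [B [h|[h|h]]|R T gR gT RT]; try rewrite -E in h.
- by case: (extend_antichain xmin h nlx).
- by case: (extend_chain_plus xmin h nlx).
- by case: nc; apply: extend_Z xmin h nlx.
case: nc; have RTx : x \in R = false /\ x \in T = false.
  have := setD11 x A; rewrite E inE => /norP[]; by move=> /negPf-> /negPf->.
have AE' : A = x |: (R :|: T) by rewrite -E setD1K.
(* If [x] were below all of [T], then [x |: R] and [T] would split [A]. *)
have [z zT xz] : exists2 z, z \in T & ~~ (x <= z).
  apply: NNPP => h; apply: ns; exists (x |: R), T; split.
  - by apply/set0Pn; exists x; rewrite !inE eqxx.
  - exact: good_sum_n0.
  - by rewrite -setUA.
  - move=> u v /setU1P[->|uR] vT; last exact: RT.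
    rewrite lt_neqAle; apply/andP; split.
      by apply: contraTneq vT => <-; rewrite RTx.2.
    by apply/negPn/negP=> xv; apply: h; exists v.
apply: (compressible_minimal_below xmin E RT (good_sum_n0 gR)).
- by case=> m; apply: good_sum_no_least.
(* [x <= r] would put [x] below [z], and [r <= x] contradicts minimality. *)
- move=> r rR; apply: incompI.
    by apply: contra xz => xr; apply: le_trans xr (ltW (RT _ _ rR zT)).
  apply/negP=> rx; have : r = x by apply: xmin.2 => //; rewrite AE' !inE rR orbT.
  by move=> rx'; rewrite rx' RTx.1 in rR.
- by exists z.
Qed.

(** * Lower bound on the number of labels of a good sum *)

Lemma represents_bits (U : finType) A (S : P -> {set U}) n :
    represents A S -> (#|\bigcup_(x in A) S x| <= n)%N ->
  exists2 v : P -> seq bool, (forall x, v x \in bits n)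
    & {in A &, forall x y, (x <= y) = bits_le (v x) (v y)}.
Proof.
move=> rS; set G := \bigcup_(x in A) S x => Gn.
(* Characteristic vectors over the labels in use, padded with [false] to length [n], so that an
   upper bound on their number suffices. *)
pose v x := [seq u \in S x | u <- enum G] ++ nseq (n - #|G|) false.
exists v => [x|x y xA yA].
  have <- : size (v x) = n by rewrite size_cat size_map size_nseq -cardE subnKC.
  exact: mem_bits.
have -> : bits_le (v x) (v y) = all (fun u => (u \in S x) ==> (u \in S y)) (enum G).
  rewrite /v /bits_le; elim: (enum G) => [|u s IH] /=; last by rewrite IH.
  by elim: (n - _)%N.
rewrite rS //; apply/subsetP/allP => [h u _|h u ux]; first exact/implyP/h.
apply: (implyP (h u _)) => //; rewrite mem_enum; apply/bigcupP; by exists x.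
Qed.

(** Antichains and [Z] are settled by bit vectors that are one label too short. For a chain plus a
    point, the sets along the chain grow strictly from a non-empty one, and the point needs a label
    outside the largest. *)
Lemma good_block_ground (U : finType) B (S : P -> {set U}) :
  good_block B -> represents B S -> (#|B| <= #|\bigcup_(x in B) S x|)%N.
Proof.
move=> gB rS; set G := \bigcup_(x in B) S x.
have SG x : x \in B -> S x \subset G by move=> xB; apply: bigcup_sup.
case: gB => [[aB]|[[C [T [[BE dCT CT] cC C2 T1]]]|[C [T [[BE dCT CT] cC C2 aT T2]]]]].
- have incB x y : x \in B -> y \in B -> x != y -> (x <= y = false) * (y <= x = false).
    by move=> xB yB xy; rewrite !(incompF (aB _ _ xB yB xy)).
  have eB : {subset enum B <= B} by move=> x; rewrite mem_enum.
  have := enum_uniq B; rewrite cardE.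
  case: (enum B) eB => [|a [|b [|c [|e [|? ?]]]]] //= eB us _.
  + have aIn : a \in B by apply: eB; rewrite !inE eqxx.
    have bIn : b \in B by apply: eB; rewrite !inE eqxx orbT.
    have ab : a != b by move: us; rewrite inE andbT.
    have h x y : x \in B -> y \in B -> x != y -> S x != S y.
      by move=> xB yB xy; apply: contraFneq (incB _ _ xB yB xy).1; rewrite rS // => ->.
    rewrite ltnNge; apply/negP=> G1.
    have [v vb vP] := represents_bits rS G1.
    have := incB _ _ aIn bIn ab; rewrite !vP //.
    by move: (vb a) (vb b); rewrite !inE => /orP[]/eqP-> /orP[]/eqP-> [].
  + have aIn : a \in B by apply: eB; rewrite !inE eqxx.
    have bIn : b \in B by apply: eB; rewrite !inE eqxx !orbT.
    have cIn : c \in B by apply: eB; rewrite !inE eqxx !orbT.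
    rewrite ltnNge; apply/negP=> G1.
    have [v vb vP] := represents_bits rS G1.
    move: us; rewrite !inE !negb_or !andbT => /andP[/andP[ab ac] bc].
    have /negP[] := bits2_no_antichain3 (vb a) (vb b) (vb c).
    by rewrite /bits_incomp -!vP // !incB // eq_sym.
  + have aIn : a \in B by apply: eB; rewrite !inE eqxx.
    have bIn : b \in B by apply: eB; rewrite !inE eqxx !orbT.
    have cIn : c \in B by apply: eB; rewrite !inE eqxx !orbT.
    have eIn : e \in B by apply: eB; rewrite !inE eqxx !orbT.
    rewrite ltnNge; apply/negP=> G1.
    have [v vb vP] := represents_bits rS G1.
    move: us; rewrite !inE !negb_or !andbT => /and3P[/and3P[ab ac ae] /andP[bc be] ce].
    have /negP[] := bits3_no_antichain4_or_Z (vb a) (vb b) (vb c) (vb e).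
    by rewrite /bits_incomp -!vP // !incB // eq_sym.
- have /cards1P[t TE] : #|T| == 1%N by apply/eqP.
  have /card_gt0P[c0 c0C] := ltnW C2.
  have CB c : c \in C -> c \in B by rewrite BE inE => ->.
  have tB : t \in B by rewrite BE TE !inE eqxx orbT.
  case: (@arg_maxnP _ c0 (mem C) (fun c => #|S c|) c0C) => m mC' mmax.
  have mC : m \in C := mC'.
  have mP c : c \in C -> c <= m.
    move=> cIn; case/orP: (cC _ _ cIn mC) => // mc; rewrite rS ?CB //.
    move: (mc); rewrite rS ?CB // => /subset_leqif_cards[_ E].
    have := mmax c cIn; rewrite /geq /= leqNgt => Sle.
    have : S m == S c.
      rewrite -E eqn_leq [X in _ && X]leqNgt Sle andbT.
      by rewrite subset_leq_card // -rS ?CB.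
    by move/eqP->.
  have Smc : (#|C| <= #|S m|)%N.
    have us : uniq [seq #|S c| | c <- enum C].
      rewrite map_inj_in_uniq ?enum_uniq // => x y; rewrite !mem_enum => xC yC E.
      have /eqP E' : S x == S y.
        case/orP: (cC _ _ xC yC); rewrite rS ?CB // => /subset_leqif_cards[_ E'].
          by rewrite -E' E.
        by rewrite eq_sym -E' E.
      by apply/eqP; rewrite eq_le !rS ?CB // E' subxx.
    (* The sizes along the chain are distinct and lie between [1] and [#|S m|]; an empty set would
       put its element below [t]. *)
    rewrite -(size_iota 1 #|S m|) cardE -(size_map (fun c => #|S c|)).
    apply: uniq_leq_size us _ => k /mapP[c]; rewrite mem_enum => cIn ->.
    rewrite mem_iota add1n ltnS subset_leq_card; last by rewrite -rS ?CB ?mP.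
    rewrite andbT card_gt0; apply/eqP=> S0; have := CT c t cIn; rewrite TE inE eqxx.
    by move=> /(_ isT) /incompF; rewrite (rS c t) ?tB ?CB // S0 sub0set => -[].
  have /subsetPn[u ut um] : ~~ (S t \subset S m).
    rewrite -rS ?tB ?CB //; have := CT m t mC.
    by rewrite TE inE eqxx => /(_ isT) /incompF[_ ->].
  have -> : #|B| = #|C|.+1.
    by rewrite BE TE setUC cardsU1; move: dCT; rewrite TE disjoint_sym disjoints1 => ->.
  apply: (@leq_trans #|u |: S m|); first by rewrite cardsU1 um add1n ltnS.
  by apply: subset_leq_card; rewrite subUset sub1set (subsetP (SG _ tB)) // SG ?CB.
- have /cards2P[a' [b' [ab' CE]]] : #|C| == 2%N by apply/eqP.
  have /cards2P[c [e [ce TE]]] : #|T| == 2%N by apply/eqP.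
  have cB : #|B| = 4.
    move: dCT; rewrite -setI_eq0 => /eqP d0.
    by rewrite BE cardsU d0 cards0 C2 T2.
  (* The pair is ordered so that [b] is not below [a], as the bit-vector check asks. *)
  have [a [b [aC bC ba]]] : exists a b, [/\ a \in C, b \in C & ~~ (b <= a)].
    case: (boolP (b' <= a')) => h; last by exists a', b'; rewrite CE !inE !eqxx orbT.
    exists b', a'; rewrite CE !inE !eqxx orbT lt_geF // lt_neqAle h eq_sym.
    by rewrite ab'.
  have cT : c \in T by rewrite TE !inE eqxx.
  have eT : e \in T by rewrite TE !inE eqxx orbT.
  have CB x : x \in C -> x \in B by rewrite BE inE => ->.
  have TB x : x \in T -> x \in B by rewrite BE inE => ->; rewrite orbT.
  rewrite cB ltnNge; apply/negP=> G1.
  have [v vb vP] := represents_bits rS G1.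
  have /negP[] := bits3_no_antichain4_or_Z (vb a) (vb b) (vb c) (vb e).
  rewrite /bits_incomp -!vP ?(CB a) ?(CB b) ?(TB c) ?(TB e) // ba.
  by rewrite !(incompF (CT _ _ aC cT)) !(incompF (CT _ _ aC eT)) !(incompF (CT _ _ bC cT))
    !(incompF (CT _ _ bC eT)) !(incompF (aT _ _ cT eT ce)).
Qed.

(** All labels of the lower part lie in every set of the upper part. Removing them there still
    represents the upper part, with disjoint labels, so the two bounds add. *)
Lemma good_sum_ground (U : finType) B (S : P -> {set U}) :
  good_sum B -> represents B S -> (#|B| <= #|\bigcup_(x in B) S x|)%N.
Proof.
move=> gB; elim: gB S => [A gA|A C gA IHA gC IHC AC] S rS.
  exact: good_block_ground.
pose G := \bigcup_(x in A) S x.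
have GS y : y \in C -> G \subset S y.
  move=> yC; apply/bigcupsP=> x xA; rewrite -rS ?inE ?xA ?yC ?orbT //.
  exact: ltW (AC _ _ xA yC).
pose S' y := S y :\: G.
have rA : represents A S by move=> x y xA yA; rewrite rS // inE ?xA ?yA.
have rC : represents C S'.
  move=> x y xC yC; rewrite rS ?inE ?xC ?yC ?orbT //.
  apply/idP/idP=> [|h]; first exact: setSD.
  apply/subsetP=> u ux; case: (boolP (u \in G)) => uG.
    exact: subsetP (GS _ yC) _ uG.
  by have := subsetP h u; rewrite !inE uG ux => /(_ isT).
rewrite card_below //; apply: leq_trans (leq_add (IHA _ rA) (IHC _ rC)) _.
rewrite -/G; set G' := \bigcup_(x in C) S' x.
have d0 : G :&: G' = set0.
  apply/setP=> u; rewrite !inE; apply/negP=> /andP[uG /bigcupP[y _]].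
  by rewrite inE uG.
have <- : #|G :|: G'| = (#|G| + #|G'|)%N by rewrite cardsU d0 cards0 subn0.
apply: subset_leq_card.
rewrite subUset; apply/andP; split; apply/bigcupsP=> x xK.
  by apply: bigcup_sup; rewrite inE xK.
by apply: subset_trans (subsetDl _ _) _; apply: bigcup_sup; rewrite inE xK orbT.
Qed.

(** * Vertical sums and existence of block decompositions *)

Lemma vertical_sum_intro A t (Q : 'I_t -> {set P}) :
    (forall i, Q i != set0) -> A = \bigcup_i Q i ->
    (forall i j : 'I_t, (i < j)%N -> below (Q i) (Q j)) ->
  vertical_sum A Q.
Proof.
move=> Q0 AE lt; split=> //.
  move=> i j; rewrite -val_eqE neq_ltn => /orP[h|h]; last rewrite disjoint_sym.
    exact: below_disjoint (lt _ _ h).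
  exact: below_disjoint (lt _ _ h).
move=> x y; rewrite AE => /bigcupP[i _ xi] /bigcupP[j _ yj]; split=> [xy|].
  case: (ltngtP i j) => [ij|ji|/val_inj ij].
  - by right; exists i, j.
  - by have := lt_le_trans (lt _ _ ji _ _ yj xi) xy; rewrite ltxx.
  - by left; exists i; split=> //; rewrite ij.
case=> [[k []]//|[k [l [kl xk yl]]]]; exact: ltW (lt _ _ kl _ _ xk yl).
Qed.

Lemma vertical_sum_below A t (Q : 'I_t -> {set P}) (i j : 'I_t) :
  vertical_sum A Q -> (i < j)%N -> below (Q i) (Q j).
Proof.
move=> [_ dis AE le] ij x y xi yj; rewrite lt_neqAle; apply/andP; split.
  apply: contraTneq yj => <-; rewrite (disjointFr (dis i j _) xi) //.
  by rewrite -val_eqE neq_ltn ij.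
apply/le; rewrite ?AE; [by apply/bigcupP; exists i | by apply/bigcupP; exists j |].
by right; exists i, j.
Qed.

Lemma splits_vertical_sum A : splits A <-> exists Q : 'I_2 -> {set P}, vertical_sum A Q.
Proof.
split=> [[A1 [A2 [A10 A20 AE lt12]]]|[Q Qv]].
  exists (fun i => if i == 0%N :> nat then A1 else A2).
  apply: vertical_sum_intro.
  - by move=> i; case: ifP.
  - by rewrite big_ord_recl big_ord1.
  - by case=> [[|[|?]] ?] [[|[|?]] ?].
exists (Q ord0), (Q ord_max); split; try by case: Qv.
- case: Qv => _ _ -> _; rewrite big_ord_recl big_ord1.
  by congr (_ :|: Q _); apply: val_inj.
- exact: vertical_sum_below Qv _.
Qed.

(** Induction on the size: a set that is no block splits, and the families of its two parts are
    concatenated. *)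
Lemma exists_block_sum A : A != set0 -> exists t (Q : 'I_t -> {set P}), block_sum A Q.
Proof.
have [n] := ubnP #|A|; elim: n A => // n IH A ltn A0.
case: (classic (block A)) => [bA|nb].
  exists 1%N, (fun=> A); split=> //; apply: vertical_sum_intro => //.
    by rewrite big_ord1.
  by move=> i j; rewrite !ord1.
have [A1 [A2 [A10 A20 AE lt12]]] : splits A.
  apply/splits_vertical_sum; apply: NNPP => h; apply: nb; split=> //; by right.
have cA : #|A| = (#|A1| + #|A2|)%N by rewrite AE card_below.
have [|t1 [Q1 [Q1v Q1b]]] := IH A1 _ A10.
  by apply: leq_trans (ltn : (#|A| <= n)%N); rewrite cA -addn1 leq_add2l card_gt0.
have [|t2 [Q2 [Q2v Q2b]]] := IH A2 _ A20.
  by apply: leq_trans (ltn : (#|A| <= n)%N); rewrite cA -add1n leq_add2r card_gt0.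
pose Q (i : 'I_(t1 + t2)) := match split i with inl j => Q1 j | inr j => Q2 j end.
exists (t1 + t2)%N, Q; split; last by move=> i; rewrite /Q; case: split.
have Q1A j : Q1 j \subset A1 by case: Q1v => _ _ -> _; apply: bigcup_sup.
have Q2A j : Q2 j \subset A2 by case: Q2v => _ _ -> _; apply: bigcup_sup.
apply: vertical_sum_intro.
- by move=> i; rewrite /Q; case: split => j; [case: Q1v|case: Q2v].
- rewrite big_split_ord AE; congr (_ :|: _).
    case: Q1v => _ _ -> _; apply: eq_bigr => i _.
    by rewrite /Q (unsplitK (inl i)).
  case: Q2v => _ _ -> _; apply: eq_bigr => i _.
  by rewrite /Q (unsplitK (inr i)).
- move=> i j; rewrite /Q; case: splitP => k ->; case: splitP => l ->.
  + by apply: vertical_sum_below Q1v.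
  + by move=> _ x y /(subsetP (Q1A _)) xA /(subsetP (Q2A _)); apply: lt12.
  + by move=> kl; have := ltn_ord l; rewrite ltnNge (leq_trans (leq_addr k t1)) // ltnW.
  + by rewrite ltn_add2l; apply: vertical_sum_below Q2v.
Qed.

(** Classical least-number principle, since being a block sum is not given as a boolean. *)
Lemma exists_least (p : nat -> Prop) :
  (exists n, p n) -> exists n, p n /\ forall m, p m -> (n <= m)%N.
Proof.
move=> [n]; elim/ltn_ind: n => n IH pn.
case: (classic (exists2 m, p m & (m < n)%N)) => [[m pm mn]|h]; first exact: IH pm.
by exists n; split=> // m pm; rewrite leqNgt; apply/negP=> mn; apply: h; exists m.
Qed.

(** [in_family] quantifies over all decompositions, so it yields information only once one
    exists. *)
Lemma exists_block_decomposition A :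
  A != set0 -> exists t (Q : 'I_t -> {set P}), block_decomposition A Q.
Proof.
move=> A0; case: (classic (block A)) => [bA|nb].
  exists 1%N, (fun=> A); split=> //; split=> //; apply: vertical_sum_intro => //.
    by rewrite big_ord1.
  by move=> i j; rewrite !ord1.
(* A sum of a single block would make [A] a block, so minimizing over all [t] respects [2 <= t]. *)
have two t (Q : 'I_t -> {set P}) : block_sum A Q -> (2 <= t)%N.
  case=> -[_ _ AE _] Qb; case: t Q AE Qb => [|[|t]] Q AE Qb //.
    by rewrite AE big_ord0 eqxx in A0.
  by case: nb; rewrite AE big_ord1.
have [|t [[Q Qs] tmin]] :=
    @exists_least (fun t => exists Q : 'I_t -> {set P}, block_sum A Q).
  by have [t [Q]] := exists_block_sum A0; exists t, Q.
exists t, Q; split=> // _; split; first exact: two Qs.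
by move=> t' Q' _ Qs'; apply: tmin; exists Q'.
Qed.

Lemma vertical_sum_good_sum A t (Q : 'I_t -> {set P}) :
  A != set0 -> vertical_sum A Q -> (forall i, good_block (Q i)) -> good_sum A.
Proof.
move=> A0 Qv gQ.
have AE : A = \bigcup_(i < t) Q i by case: Qv.
(* The binary sum is assembled from the bottom, one block at a time. *)
have H k : (k < t)%N -> good_sum (\bigcup_(i < t | (i <= k)%N) Q i).
  elim: k => [|k IH] kt.
    rewrite (big_pred1 (Ordinal kt)); first exact: GoodBlock.
    by move=> i; rewrite leqn0.
  rewrite (bigD1 (Ordinal kt)) //= setUC.
  rewrite (eq_bigl (fun i : 'I_t => (i <= k)%N)); last first.
    by move=> i; rewrite -val_eqE /= andbC -ltn_neqAle ltnS.
  apply: GoodSum; [exact: IH (ltnW kt) | exact: GoodBlock |].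
  by move=> x y /bigcupP[i ik xi] yk; apply: (vertical_sum_below Qv _ xi yk).
case: t Q Qv gQ AE H => [|t] Q Qv gQ AE H; first by rewrite AE big_ord0 eqxx in A0.
rewrite AE; have := H t (ltnSn t); congr good_sum; apply: eq_bigl => i.
by rewrite -ltnS ltn_ord.
Qed.

(** The summands below and above [Q i] are merged into [L] and [R], so that the binary lemmas
    apply. *)
Lemma compressible_vertical_sum A t (Q : 'I_t -> {set P}) i :
  vertical_sum A Q -> compressible (Q i) -> compressible A.
Proof.
move=> Qv cQ.
pose L := \bigcup_(j < t | (j < i)%N) Q j; pose R := \bigcup_(j < t | (i < j)%N) Q j.
have -> : A = L :|: (Q i :|: R).
  case: (Qv) => _ _ -> _; apply/setP=> x; rewrite !inE.
  apply/bigcupP/or3P=> [[j _ xj]|[/bigcupP[j _ xj]|xi|/bigcupP[j _ xj]]].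
  - case: (ltngtP j i) => [ji|ij|/val_inj ji].
    + by constructor 1; apply/bigcupP; exists j.
    + by constructor 3; apply/bigcupP; exists j.
    + by constructor 2; rewrite -ji.
  - by exists j.
  - by exists i.
  - by exists j.
apply: compressible_below_r; last first.
  apply: compressible_below_l => // x y xi /bigcupP[j ij yj].
  exact: vertical_sum_below Qv ij _ _ xi yj.
move=> x y /bigcupP[j ji xj]; rewrite inE => /orP[yi|/bigcupP[k ik yk]].
  exact: vertical_sum_below Qv ji _ _ xj yi.
exact: vertical_sum_below Qv (ltn_trans ji ik) _ _ xj yk.
Qed.

(** * From blocks to the dimension *)

Lemma block_good A : block A -> ~ compressible A -> good_block A.
Proof.
move=> [A0 [cA|[_ np]]] nc; first by case: nc; apply: compressible_chain.
have gA := incompressible_good_sum A0 nc.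
(* A good sum with two summands splits, contrary to primality. *)
case: gA A0 nc np => // B C gB gC BC _ _ [].
apply/splits_vertical_sum; exists B, C; split=> //; exact: good_sum_n0.
Qed.

(** Down-sets always give a representation with [#|P|] labels, so equality fails exactly when fewer
    suffice. *)
Lemma dim2_eq_card : dim2 P = #|P| <-> ~ compressible [set: P].
Proof.
have bigE (U : finType) (S : P -> {set U}) : \bigcup_(x in [set: P]) S x = \bigcup_x S x.
  by apply: eq_bigl => x; rewrite inE.
have [[U [S [rS cS]]] dmin] := dim2P P.
split=> [E [V [S' [rS' ltS']]]|nc].
  rewrite cardsT bigE -E ltnNge in ltS'; case/negP: ltS'; apply: dmin.
  by exists V, S'; split=> // x y; rewrite (rS' x y).
have le : (#|P| <= dim2 P)%N.
  rewrite leqNgt; apply/negP=> lt; apply: nc; exists U, S; rewrite bigE cS cardsT.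
  by split=> // x y _ _; apply/idP/idP=> /rS.
apply/eqP; rewrite eqn_leq le andbT.
apply: (@leq_trans #|\bigcup_(x : P) [set z : P | z <= x]|); last exact: max_card.
apply: dmin; exists P, (fun x => [set z : P | z <= x]); split=> // x y.
split=> [xy|/subsetP/(_ x)]; last by rewrite !inE lexx => /(_ isT).
by apply/subsetP=> z; rewrite !inE => /le_trans; apply.
Qed.

End Dimension.

Theorem theorem5p1 (d : Order.disp_t) (P : finPOrderType d) (hP : 0 < #|P|) :
  dim2 P = #|P| <-> in_family P.
Proof.
have P0 : [set: P] != set0 by rewrite -card_gt0 cardsT.
rewrite dim2_eq_card; split=> [nc t Q [[Qv Qb] _ _] i|fam [U [S [rS]]]].
  (* A compressible block would compress the whole poset. *)
  by apply: block_good => // c; apply: nc; apply: compressible_vertical_sum Qv c.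
have [t [Q Qd]] := exists_block_decomposition P0.
have [Qv _] : block_sum [set: P] Q by case: Qd.
apply/negP; rewrite -leqNgt; apply: good_sum_ground rS.
exact: vertical_sum_good_sum P0 Qv (fam _ _ Qd).
Qed.
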